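(* Let $X$ be a Polish space without isolated points, let $f\colon X\to\mathbb{R}$, let $\mu$ be a finite nonatomic Borel measure on $X$ with $\mu(X)>0$, and let $\Sigma:=\mathrm{Perf}^+$ be the family of all perfect subsets of $X$ of positive $\mu$-measure. Then the game $G_1(\Sigma,f)$ is determined, and - if $f$ is measurable with respect to the completion of $\mu$, then Player II has a winning strategy in the game $G_1(\Sigma,f)$; - if $f$ is not measurable with respect to the completion of $\mu$, then Player I has a winning strategy in the game $G_1(\Sigma,f)$.
   Context: A perfect set is a closed set without isolated points. The game $G_1(\Sigma,f)$, for a non-empty family $\Sigma$ of non-empty subsets of $X$ and $f\colon X\to\mathbb{R}$: Player I plays $P\in\Sigma$, Player II plays $P_0$; then at the $n$th step ($n\ge1$) Player I plays a point $x_n$ and Player II plays a set $P_n$. The rules are: $P_n\in\Sigma$ and $P_n\subseteq P$ for all $n\ge0$ (the $P_n$ need not be decreasing), and $x_{n+1}\in P_n$ for all $n\ge 0$. Player II wins if $\langle x_n\rangle$ converges in $X$ and $\lim_{n}f(x_n)=f(\lim_{n}x_n)$; otherwise Player I wins. The game is determined if one of the players has a winning strategy. *)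

(* Defs.v *)
From HB Require Import structures.
From mathcomp Require Export all_boot all_order all_algebra.
From mathcomp Require Export all_classical all_reals all_analysis.
From mathcomp Require Export measurable_realfun.
Export numFieldNormedType.Exports.

Set Implicit Arguments.
Unset Strict Implicit.
Unset Printing Implicit Defensive.

Import Order.TTheory GRing.Theory Num.Theory.

Local Open Scope classical_set_scope.
Local Open Scope ring_scope.

Definition is_metric (R : realType) (X : Type) (d : X -> X -> R) : Prop :=
  [/\ forall x y, 0 <= d x y,
      forall x y, d x y = 0 <-> x = y,
      forall x y, d x y = d y x &
      forall x y z, d x z <= d x y + d y z].

Definition metrizes (R : realType) (X : topologicalType) (d : X -> X -> R) :
    Prop :=
  forall (x : X) (A : set X),
    nbhs x A <-> exists2 e : R, 0 < e & [set y | d x y < e] `<=` A.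

Definition metric_complete (R : realType) (X : topologicalType)
    (d : X -> X -> R) : Prop :=
  forall u : nat -> X,
    (forall e : R, 0 < e -> exists N : nat, forall m n : nat,
       (N <= m)%N -> (N <= n)%N -> d (u m) (u n) < e) ->
    exists l : X, u @ \oo --> l.

Definition polish (R : realType) (X : topologicalType) : Prop :=
  (exists2 D : set X, countable D & dense D) /\
  exists d : X -> X -> R, [/\ is_metric d, metrizes d & metric_complete d].

Section Nonatomic.
Local Open Scope ereal_scope.

Definition atom (d : measure_display) (T : measurableType d) (R : realType)
    (mu : set T -> \bar R) (A : set T) : Prop :=
  [/\ measurable A, 0 < mu A &
      forall B, measurable B -> B `<=` A -> mu B = 0 \/ mu B = mu A].

Definition nonatomic (d : measure_display) (T : measurableType d)
    (R : realType) (mu : set T -> \bar R) : Prop :=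
  forall A, ~ atom mu A.

End Nonatomic.

(* [completed_algebra_gen mu] consists of the sets [A `|` N] with [A]
   measurable and [N] negligible: it is already the sigma-algebra of the
   completion of [mu], so that generating a sigma-algebra from it adds nothing. *)
Definition completion_measurable (d : measure_display) (T : measurableType d)
    (R : realType) (mu : {measure set T -> \bar R}) (f : T -> R) : Prop :=
  measurable_fun [set: g_sigma_algebraType (completed_algebra_gen mu)] f.

Definition perf_plus (R : realType) (X : ptopologicalType)
    (mu : set (g_sigma_algebraType (@open X)) -> \bar R) : set (set X) :=
  [set P | perfect_set P /\ (0 < mu P)%E].

(* In a run of the game, Player I plays [P], Player II plays [Q 0], then
   Player I plays [x 0], Player II plays [Q 1], Player I plays [x 1], and so on.
   The first point is thus [x 0], i.e. points are numbered one less than usual,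
   and the rule on points reads [Q n (x n)].
   A strategy gives the next move of a player as a function of the finite list
   of the moves of the opponent so far. It is winning when, against every play
   of the opponent, it makes legal moves for as long as the opponent does, and
   the resulting run is won if the opponent's moves are all legal. *)
Section Game.
Variables (R : realType) (X : topologicalType).
Variables (Sigma : set (set X)) (f : X -> R).

Definition II_wins_run (x : nat -> X) : Prop :=
  exists2 l : X, x @ \oo --> l & (f \o x) @ \oo --> f l.

Definition legal_II (P Q : set X) : Prop := Sigma Q /\ Q `<=` P.

Definition winning_I (P : set X) (s : seq (set X) -> X) : Prop :=
  Sigma P /\
  forall Q : nat -> set X,
    let x := fun n => s (mkseq Q n.+1) in
    (forall n, (forall k, (k <= n)%N -> legal_II P (Q k)) -> Q n (x n)) /\
    ((forall n, legal_II P (Q n)) -> ~ II_wins_run x).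

Definition winning_II (t : set X -> seq X -> set X) : Prop :=
  forall (P : set X) (x : nat -> X), Sigma P ->
    let Q := fun n => t P (mkseq x n) in
    (forall n, (forall k, (k < n)%N -> Q k (x k)) -> legal_II P (Q n)) /\
    ((forall n, Q n (x n)) -> II_wins_run x).

Definition I_has_winning_strategy : Prop := exists P s, winning_I P s.

Definition II_has_winning_strategy : Prop := exists t, winning_II t.

Definition G1_determined : Prop :=
  I_has_winning_strategy \/ II_has_winning_strategy.

End Game.

(* Main.v *)
From mathcomp Require Import lra.
Require Import Defs.

(** The theorem rests on a dichotomy for the oscillation of [f] on the sets of
    [Sigma], the perfect sets of positive measure.

    If [f] is measurable for the completion, every [P] in [Sigma] and every
    [e > 0] admit some [Q] in [Sigma] inside [P] with the diameters of [Q] and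
    of [f @` Q] below [e] ([perf_plus_refine]): countably many balls, and
    countably many preimages of short intervals, cover [P], so one of the pieces
    contains a Borel set of positive measure, and every Borel set of positive
    measure contains a member of [Sigma] ([pos_measure_perf_plus]).  Player II
    plays a decreasing sequence of such sets with [e = 1 / (n + 1)].  Whatever
    points Player I picks form a Cauchy sequence; its limit lies in all the
    sets played, which are closed, so the values of [f] along the run converge
    to the value at the limit ([II_has_winning_strategy_of_refinement]).

    If [f] is not measurable for the completion, there are reals [a < b] such
    that no Borel set separates [f <= a] from [f >= b] up to a null set
    ([completion_measurable_of_separation]).  Let [A] and [B] be Borel sets,
    maximal modulo null sets, inside [f < b] and [a < f]
    ([maximal_measurable_subset]).  The complement of their union then has
    positive measure, hence contains some [P] in [Sigma]; by maximality every
    member of [Sigma] inside [P] contains points where [f <= a] and points where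
    [b <= f] ([perf_plus_gap]).  Player I starts with [P] and alternates between
    the two kinds of points, so that the values of [f] do not converge
    ([winning_I_of_gap]).

    The passage from Borel sets of positive measure to members of [Sigma] uses
    the regularity of finite Borel measures on metric spaces
    ([borel_inner_closed]) and the support of the measure restricted to a closed
    set, which is perfect because points are null. *)

Set Implicit Arguments.
Unset Strict Implicit.
Unset Printing Implicit Defensive.

Import Order.TTheory GRing.Theory Num.Theory.

Local Open Scope classical_set_scope.
Local Open Scope ring_scope.

(** * Metric topology *)

Section Metric.
Variables (R : realType) (X : topologicalType) (d : X -> X -> R).
Hypotheses (dM : is_metric d) (dX : metrizes d).

Lemma metric_ge0 x y : 0 <= d x y. Proof. by case: dM. Qed.

Lemma metric_refl x : d x x = 0.
Proof. by case: dM => _ /(_ x x) h _ _; apply/h. Qed.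

Lemma metric_sym x y : d x y = d y x. Proof. by case: dM. Qed.

Lemma metric_triangle y x z : d x z <= d x y + d y z. Proof. by case: dM. Qed.

Lemma open_metric_ball x (e : R) : open [set y | d x y < e].
Proof.
rewrite openE => y /= xy; apply/dX; exists (e - d x y); first by rewrite subr_gt0.
move=> z /= yz; apply: le_lt_trans (metric_triangle y x z) _.
by rewrite addrC -ltrBrDr.
Qed.

Lemma closed_metric_set1 (x : X) : closed [set x].
Proof.
rewrite -[[set x]]setCK; apply: open_closedC; rewrite openE => y /eqP yx.
apply/dX; exists (d y x).
  rewrite lt_neqAle metric_ge0 andbT eq_sym; apply/eqP => h.
  by case: dM => _ /(_ y x)[+ _] _ _ => /(_ h)/eqP; exact/negP.
by move=> z /= + zx; rewrite zx ltxx.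
Qed.

(** The closed sets are the sets of points at distance at least [1 / (n + 1)]
    from the complement of [U]. *)
Lemma open_bigcup_closed (U : set X) : open U ->
  exists2 F : (set X)^nat, forall n, closed (F n) & U = \bigcup_n F n.
Proof.
move=> oU.
exists (fun n => [set x | forall y, ~ U y -> n.+1%:R^-1 <= d y x]) => [n|].
  rewrite (_ : mkset _ =
      ~` (\bigcup_(y in ~` U) [set x | d y x < n.+1%:R^-1])).
    by apply/open_closedC/bigcup_open => y _; exact: open_metric_ball.
  apply/seteqP; split=> x /= h; first by move=> [y Uy /=]; rewrite ltNge h.
  by move=> y Uy; rewrite leNgt; apply/negP => yx; apply: h; exists y.
apply/seteqP; split=> [x Ux|x [n _ /= h]]; last first.
  apply: contrapT => Ux; have := h x Ux.
  by rewrite metric_refl leNgt invr_gt0 ltr0n.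
have /dX[e e0 eU] : nbhs x U by apply: open_nbhs_nbhs.
have [n _ ne] := @near_infty_natSinv_lt R (PosNum e0).
exists n => // y Uy; apply: (le_trans (ltW (ne n (leqnn n)))).
by rewrite leNgt metric_sym; apply/negP => /eU.
Qed.

Lemma separable_dense_seq : (exists2 D : set X, countable D & dense D) ->
  X -> exists u : nat -> X,
    forall x (e : R), 0 < e -> exists n, d (u n) x < e.
Proof.
move=> [D cD dD] x0.
have h x e : 0 < e -> exists2 y, D y & d y x < e.
  move=> e0; have [||y [xy Dy]] := dD [set y | d x y < e].
  - by exists x; rewrite /= metric_refl.
  - exact: open_metric_ball.
  - by exists y => //; rewrite metric_sym.
have [D0|[u]] := pfcard_geP cD.
  by have [y] := h x0 1 ltr01; rewrite D0.
exists u => x e /(h x)[y Dy yx].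
by have [n _ un] := 'surj_u Dy; exists n; rewrite un.
Qed.

End Metric.

(** * Strategies from oscillation conditions *)

Section Strategies.
Variables (R : realType) (X : topologicalType).
Variables (Sigma : set (set X)) (f : X -> R).

(** The kind of point picked in [Q n] depends on the parity of [n]: the values of
    [f] along the run are alternately [<= a] and [>= b], so they have no
    limit. *)
Lemma winning_I_of_gap (P : set X) (a b : R) (x0 : X) : Sigma P -> a < b ->
  (forall Q, legal_II Sigma P Q ->
     (exists2 x, Q x & f x <= a) /\ (exists2 x, Q x & b <= f x)) ->
  I_has_winning_strategy Sigma f.
Proof.
move=> SP ab gap.
have /choice[c cP] : forall Qn : set X * nat, exists x, legal_II Sigma P Qn.1 ->
    Qn.1 x /\ if odd Qn.2 then f x <= a else b <= f x.
  move=> [Q n] /=; have [/gap[[x ? ?] [y ? ?]]|?] := pselect (legal_II Sigma P Q).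
    by case: (odd n); [exists x|exists y].
  by exists x0.
(* The [n]-th reply sees a list of size [n.+1], whence the shift of parity. *)
exists P, (fun s => c (last set0 s, size s)); split=> // Q x.
have xE n : x n = c (Q n, n.+1).
  by rewrite /x size_mkseq (last_nth set0) size_mkseq -nth_behead ?nth_mkseq.
have xP n : legal_II Sigma P (Q n) ->
  Q n (x n) /\ if odd n.+1 then f (x n) <= a else b <= f (x n).
  by rewrite xE; exact: cP (Q n, n.+1).
split=> [n QP|QP [l _ fl]]; first by have [] := xP n (QP n (leqnn n)).
(* Two consecutive values would both be within half of the gap of the limit. *)
have /cvgrPdist_lt/(_ ((b - a) / 2)) := fl.
rewrite divr_gt0 ?subr_gt0// => /(_ isT)[N _ Nl].
have [_] := xP N.*2 (QP _); have [_] := xP N.*2.+1 (QP _).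
rewrite /= !odd_double /=.
have := Nl N.*2; have := Nl N.*2.+1; rewrite /= -addnn.
rewrite leqW ?leq_addr// => /(_ isT) + /(_ isT).
rewrite /comp !ltr_norml => /andP[? ?] /andP[? ?] ? ?.
by lra.
Qed.

(** Player II shrinks her own previous move and ignores the points played: once
    the diameters tend to [0], any choice of points yields a good limit. *)
Lemma II_has_winning_strategy_of_refinement (d : X -> X -> R) :
  is_metric d -> metrizes d -> metric_complete d ->
  Sigma `<=` closed ->
  (forall P (e : R), Sigma P -> 0 < e -> exists2 Q, legal_II Sigma P Q &
     forall x y, Q x -> Q y -> d x y < e /\ `|f x - f y| < e) ->
  II_has_winning_strategy Sigma f.
Proof.
move=> dM dX dC Scl refine.
have /choice[r rP] : forall Pn : set X * nat, exists Q, Sigma Pn.1 ->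
    legal_II Sigma Pn.1 Q /\ forall x y, Q x -> Q y ->
      d x y < Pn.2.+1%:R^-1 /\ `|f x - f y| < Pn.2.+1%:R^-1.
  move=> [P n] /=; have [SP|nSP] := pselect (Sigma P); last by exists set0.
  by have [|Q ? ?] := refine P n.+1%:R^-1 SP; [rewrite invr_gt0|exists Q].
pose T P := fix T n := if n is n'.+1 then r (T n', n) else r (P, 0%N).
exists (fun P s => T P (size s)) => P x SP Q.
have QE n : Q n = T P n by rewrite /Q size_mkseq.
have QS n : Sigma (Q n).
  rewrite QE; elim: n => [|n IH] /=; first by have [[]] := rP (P, 0%N) SP.
  by have [[]] := rP (T P n, n.+1) IH.
have QR n y z : Q n y -> Q n z -> d y z < n.+1%:R^-1 /\ `|f y - f z| < n.+1%:R^-1.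
  rewrite QE; case: n => [|n] /= Qy Qz.
    by have [_ /(_ y z Qy Qz)] := rP (P, 0%N) SP.
  by have := QS n; rewrite QE => /(rP (T P n, n.+1))[_ /(_ y z Qy Qz)].
have QSn n : Q n.+1 `<=` Q n.
  by have := QS n; rewrite !QE => /(rP (T P n, n.+1))[[]].
have Qdecr m n : (m <= n)%N -> Q n `<=` Q m.
  elim: n => [|n IH]; first by rewrite leqn0 => /eqP->.
  by rewrite leq_eqVlt => /predU1P[->//|/IH]; apply: subset_trans.
have QP n : Q n `<=` P.
  apply: (subset_trans (Qdecr _ _ (leq0n n))); rewrite QE /=.
  by have [[]] := rP (P, 0%N) SP.
split=> [n _|Qx]; first by split.
have small (e : R) : 0 < e -> exists N, forall y z, Q N y -> Q N z ->
    d y z < e /\ `|f y - f z| < e.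
  move=> e0; have [N _ Ne] := @near_infty_natSinv_lt R (PosNum e0).
  exists N => y z Qy Qz; have [? ?] := QR N y z Qy Qz.
  by have /= ? := Ne N (leqnn N); split; apply: lt_trans; eassumption.
have [e e0|l xl] := dC x.
  have [N Ne] := small e e0; exists N => m n Nm Nn.
  by apply: (Ne _ _ _ _).1; apply: Qdecr (Qx _).
have Ql n : Q n l.
  apply: (@closed_cvg _ _ \oo _ x (Q n)) xl; first exact: Scl.
  by exists n => // m /= nm; exact: Qdecr (Qx m).
exists l => //; apply/cvgrPdist_lt => e e0.
have [N Ne] := small e e0; exists N => // n /= Nn.
by apply: (Ne _ _ _ _).2 => //; apply: Qdecr (Qx _).
Qed.

End Strategies.

(** * The completion of a measure *)

Section Completion.
Context d (T : measurableType d) (R : realType).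
Variable mu : {measure set T -> \bar R}.

(** Unlike the decomposition as a union, the inner kernel [A] has a negligible
    defect, which is the form that passes to complements and intersections. *)
Lemma completed_algebra_genP (S : set T) : completed_algebra_gen mu S <->
  exists A, [/\ measurable A, A `<=` S & mu.-negligible (S `\` A)].
Proof.
split=> [[A mA [N nN <-]]|[A [mA AS nSA]]].
  exists A; split; [by []|by move=> x; left|].
  by apply: negligibleS nN => x [[]].
by exists A => //; exists (S `\` A) => //; rewrite setDUK.
Qed.

Lemma completed_algebra_gen_bigcup (S : (set T)^nat) :
  (forall n, completed_algebra_gen mu (S n)) ->
  completed_algebra_gen mu (\bigcup_n S n).
Proof.
move=> /(_ _)/completed_algebra_genP-/choice[A SA].
apply/completed_algebra_genP; exists (\bigcup_n A n); split.
- by apply: bigcupT_measurable => n; have [] := SA n.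
- by apply: subset_bigcup => n _; have [] := SA n.
- apply: (@negligibleS _ _ _ mu (\bigcup_n (S n `\` A n))).
    by move=> x [[n _ Snx] nA]; exists n => //; split=> // Ax; apply: nA; exists n.
  by apply: negligible_bigcup => n; have [] := SA n.
Qed.

Lemma completed_algebra_genC (S : set T) :
  completed_algebra_gen mu S -> completed_algebra_gen mu (~` S).
Proof.
move=> /completed_algebra_genP[A [mA AS [F [mF F0 SAF]]]].
apply/completed_algebra_genP; exists (~` (A `|` F)); split.
- by apply/measurableC/measurableU.
- by move=> x AF Sx; apply/AF; have [?|nA] := pselect (A x); [left|right; apply: SAF].
- exists F; split=> // x [nS /contrapT[/AS//|//]].
Qed.

(** The sets that differ from a measurable set by a negligible one already form a
    sigma-algebra, so measurability for the generated sigma-algebra yields an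
    actual decomposition. *)
Lemma completion_measurable_preimage (f : T -> R) (B : set R) :
  completion_measurable mu f -> measurable B ->
  completed_algebra_gen mu (f @^-1` B).
Proof.
move=> mf mB; have := mf measurableT B mB; rewrite setTI.
apply: smallest_sub; last by [].
split.
- by exists set0 => //; exists set0; [exact: negligible_set0|rewrite setU0].
- by move=> S; rewrite setTD; exact: completed_algebra_genC.
- exact: completed_algebra_gen_bigcup.
Qed.

(** The intersection of the separating sets for [a] and [a + 1 / (n + 1)] lies in
    [f <= a] and exhausts it up to a null set. *)
Lemma completion_measurable_of_separation (f : T -> R) :
  (forall a b : R, a < b -> exists A, [/\ measurable A,
     A `<=` [set x | f x < b] & mu.-negligible ([set x | f x <= a] `\` A)]) ->
  completion_measurable mu f.
Proof.
move=> sep; rewrite /completion_measurable.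
apply: (measurability _ (RGenOInfty.measurableE R)).
move=> _ [_ [a ->] <-]; apply: sub_sigma_algebra.
rewrite setTI (_ : _ @^-1` _ = ~` [set x | f x <= a]); last first.
  by apply/seteqP; split=> x /=; rewrite in_itv /= andbT ltNge => /negP.
apply/completed_algebra_genC/completed_algebra_genP.
have /choice[A Aa] n : exists A, [/\ measurable A,
    A `<=` [set x | f x < a + n.+1%:R^-1]
    & mu.-negligible ([set x | f x <= a] `\` A)].
  by apply: sep; rewrite ltrDl invr_gt0.
exists (\bigcap_n A n); split.
- by apply: bigcapT_measurable => n; have [] := Aa n.
- move=> x Ax /=; apply/ler_addgt0Pr => e e0.
  have [n _ ne] := @near_infty_natSinv_lt R (PosNum e0).
  have [_ /(_ x (Ax n I))/= fx _] := Aa n.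
  by apply/ltW/(lt_trans fx); rewrite ltrD2l; exact: ne (leqnn n).
- apply: (@negligibleS _ _ _ mu (\bigcup_n ([set x | f x <= a] `\` A n))).
    by move=> x [fx /existsNP[n /not_implyP[_ ?]]]; exists n.
  by apply: negligible_bigcup => n; have [] := Aa n.
Qed.

(** Each [S n] is measurable up to a null set, so if the measurable kernels of
    all the [S n] met [P] in null sets, [P] would be null. *)
Lemma pos_measure_cover (P : set T) (S : (set T)^nat) :
  measurable P -> (0 < mu P)%E ->
  (forall n, completed_algebra_gen mu (S n)) -> P `<=` \bigcup_n S n ->
  exists n B, [/\ measurable B, B `<=` P `&` S n & (0 < mu B)%E].
Proof.
move=> mP P0 /(_ _)/completed_algebra_genP-/choice[A SA] PS.
apply: contrapT => none; move: P0; apply/negP; rewrite -leNgt measure_le0.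
apply/eqP/measure_negligible => //.
apply: (@negligibleS _ _ _ mu (\bigcup_n ((P `&` A n) `|` (S n `\` A n)))).
  move=> x Px; have [n _ Sx] := PS _ Px; exists n => //.
  by have [?|?] := pselect (A n x); [left|right].
apply: negligible_bigcup => n; have [mA AS nSA] := SA n.
apply: negligibleU => //; apply/negligibleP; first exact: measurableI.
apply/eqP; rewrite -measure_le0 leNgt; apply/negP => PA0.
by apply: none; exists n, (P `&` A n); split=> //;
  [exact: measurableI|exact: setIS].
Qed.

End Completion.

(** * Maximal measurable subsets *)

Section Maximal.
Context d (T : measurableType d) (R : realType).
Variable mu : {finite_measure set T -> \bar R}.

(** The supremum of the measures of the measurable subsets of [S] is attained, by
    the union of a maximizing sequence; since it is finite, nothing of positive
    measure can be added to that union. *)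
Lemma maximal_measurable_subset (S : set T) : exists A, [/\ measurable A,
  A `<=` S & forall B, measurable B -> B `<=` S `\` A -> mu B = 0%E].
Proof.
pose E := [set mu A | A in [set A | measurable A /\ A `<=` S]].
have [|u Eu cu] := @ereal_sup_seq R E.
  by apply/set0P; exists (mu set0), set0; split=> //; exact: sub0set.
have /choice[A AP] n : exists A, (measurable A /\ A `<=` S) /\ mu A = u n.
  by have [A ? ?] := Eu n; exists A.
have mA : measurable (\bigcup_n A n).
  by apply: bigcupT_measurable => n; have [[]] := AP n.
have AS : \bigcup_n A n `<=` S by apply: bigcup_sub => n _; have [[]] := AP n.
exists (\bigcup_n A n); split=> // B mB BSA; apply/eqP; rewrite -measure_le0.
have : (mu ((\bigcup_n A n) `|` B) <= ereal_sup E)%E.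
  apply: ereal_sup_ubound; exists ((\bigcup_n A n) `|` B) => //; split.
    exact: measurableU.
  by move=> x [/AS//|/BSA[]].
have : (ereal_sup E <= mu (\bigcup_n A n))%E.
  have <- : limn u = ereal_sup E by apply/cvg_lim.
  apply: lime_le; first by apply/cvg_ex; exists (ereal_sup E).
  apply: nearW => n; have [[mAn _] <-] := AP n.
  by apply: le_measure; rewrite ?inE//; exact: bigcup_sup.
move=> h1 h2; have := le_trans h2 h1.
rewrite measureU//; last by apply/seteqP; split=> // x [Ax /BSA[]].
by rewrite -[leRHS]adde0 leeD2lE// fin_num_measure.
Qed.
End Maximal.

(** * Perfect sets of positive measure *)

Section Regularity.
Variables (R : realType) (X : ptopologicalType).
Notation T := (g_sigma_algebraType (@open X)).
Variable mu : {finite_measure set T -> \bar R}.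

Lemma borel_open (U : set X) : open U -> measurable (U : set T).
Proof. exact: sub_sigma_algebra. Qed.

Lemma borel_closed (C : set X) : closed C -> measurable (C : set T).
Proof.
move=> cC; rewrite -[C]setCK; apply: measurableC.
by apply: borel_open; exact: closed_openC.
Qed.

(** Inner regularity is stated with the defect [mu (A `\` F)] rather than as a
    supremum of measures, so that the defects of a sequence of sets can be
    summed. *)
Definition inner_closed (A : set T) := forall e : R, 0 < e ->
  exists F : set X, [/\ closed F, F `<=` A & (mu (A `\` F) <= e%:E)%E].

Lemma inner_closed_closed (F : set X) : closed F -> inner_closed F.
Proof.
by move=> cF e e0; exists F; split=> //; rewrite setDv measure0 lee_fin ltW.
Qed.

Lemma inner_closed_seq (A : (set T)^nat) (e : R) : 0 < e ->
  (forall n, inner_closed (A n)) ->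
  exists F : (set X)^nat, forall n, [/\ closed (F n), F n `<=` A n &
    (mu (A n `\` F n) <= (e / (2 ^ n.+1)%:R)%:E)%E].
Proof.
move=> e0 iA.
have /choice[F FA] n : exists F : set X, [/\ closed F, F `<=` A n &
    (mu (A n `\` F) <= (e / (2 ^ n.+1)%:R)%:E)%E].
  by apply: iA; rewrite divr_gt0// ltr0n expn_gt0.
by exists F.
Qed.

Lemma measure_bigcup_geometric (B : (set T)^nat) (e : R) : 0 <= e ->
  (forall n, measurable (B n)) ->
  (forall n, (mu (B n) <= (e / (2 ^ n.+1)%:R)%:E)%E) ->
  (mu (\bigcup_n B n) <= e%:E)%E.
Proof.
move=> e0 mB Be; apply: le_trans (epsilon_trick0 xpredT e0).
apply: (@le_trans _ _ (\sum_(n <oo) mu (B n))%E).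
  by apply: generalized_Boole_inequality => //; exact: bigcupT_measurable.
by apply: lee_nneseries => [n _ _|n _]; [exact: measure_ge0|exact: Be].
Qed.

Lemma inner_closed_bigcap (A : (set T)^nat) : (forall n, measurable (A n)) ->
  (forall n, inner_closed (A n)) -> inner_closed (\bigcap_n A n).
Proof.
move=> mA iA e e0; have [F FA] := inner_closed_seq e0 iA.
have mAF n : measurable (A n `\` F n).
  by apply: measurableD => //; apply: borel_closed; have [] := FA n.
exists (\bigcap_n F n); split.
- by apply: closed_bigI => n _; have [] := FA n.
- by apply: subset_bigcap => n _; have [] := FA n.
- apply: le_trans (measure_bigcup_geometric (ltW e0) mAF _); last first.
    by move=> n; have [] := FA n.
  apply: le_measure; rewrite ?inE.
  + apply: measurableD; first exact: bigcapT_measurable.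
    by apply: bigcapT_measurable => n; apply: borel_closed; have [] := FA n.
  + exact: bigcupT_measurable.
  + by move=> x [Ax /existsNP[n /not_implyP[_ ?]]]; exists n => //; split=> //; apply: Ax.
Qed.

(** The union of the approximating closed sets need not be closed; a long enough
    finite union is, and it loses arbitrarily little more by continuity of the
    measure from above.  Hence the budget [e / 2] for the sequence. *)
Lemma inner_closed_bigcup (A : (set T)^nat) : (forall n, measurable (A n)) ->
  (forall n, inner_closed (A n)) -> inner_closed (\bigcup_n A n).
Proof.
move=> mA iA e e0; have e20 : 0 < e / 2 by rewrite divr_gt0.
have [F FA] := inner_closed_seq e20 iA.
have mF n : measurable (F n : set T) by apply: borel_closed; have [] := FA n.
have mUA : measurable (\bigcup_n A n) by exact: bigcupT_measurable.
pose G n : set T := \bigcup_n A n `\` \big[setU/set0]_(i < n) F i.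
have mG n : measurable (G n).
  by apply: measurableD => //; exact: bigsetU_measurable.
have GE : \bigcap_n G n = \bigcup_n A n `\` \bigcup_n F n.
  apply/seteqP; split=> [x Gx|x [Ax nF] n _].
    split; first by have [] := Gx 0%N I.
    move=> [n _ Fx]; have [_] := Gx n.+1 I; apply.
    by rewrite big_ord_recr; right.
  by split=> //; rewrite -bigcup_mkord => -[i _ Fx]; apply: nF; exists i.
have : (mu (\bigcap_n G n) < e%:E)%E.
  apply: (@le_lt_trans _ _ (e / 2)%:E); last by rewrite lte_fin; lra.
  have mAF n : measurable (A n `\` F n) by exact: measurableD.
  apply: le_trans (measure_bigcup_geometric (ltW e20) mAF _); last first.
    by move=> n; have [] := FA n.
  apply: le_measure; rewrite ?inE.
  + exact: bigcapT_measurable.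
  + exact: bigcupT_measurable.
  + rewrite GE => x [[n _ Ax] nF]; exists n => //; split=> // Fx.
    by apply: nF; exists n.
move=> Ge.
have : mu (G n) @[n --> \oo] --> mu (\bigcap_n G n).
  apply: nonincreasing_cvg_mu => //.
  - by rewrite ltey_eq fin_num_measure.
  - exact: bigcapT_measurable.
  - move=> m n mn; apply/subsetPset; apply: setDS.
    by rewrite -!bigcup_mkord => x [i /= im ?]; exists i => //=; exact: leq_trans mn.
have : nbhs (mu (\bigcap_n G n)) [set y | (y < e%:E)%E].
  by apply: open_nbhs_nbhs; split=> //; exact: open_ereal_lt_ereal.
move=> /[swap]/[apply] -[n _ /(_ n (leqnn n))/= Gn].
exists (\big[setU/set0]_(i < n) F i); split; last exact: ltW.
- by apply: closed_bigsetU => i _; have [] := FA i.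
- by rewrite -bigcup_mkord => x [i _ Fx]; exists i => //; have [_ + _] := FA i; apply.
Qed.

Variable dist : X -> X -> R.
Hypotheses (dM : is_metric dist) (dX : metrizes dist).

(** The sets that are inner regular together with their complements form a
    sigma-algebra.  It contains the open sets, as these are countable unions of
    closed sets. *)
Lemma borel_inner_closed (A : set T) : measurable A -> inner_closed A.
Proof.
move=> mA; suff [] : [/\ measurable A, inner_closed A & inner_closed (~` A)] by [].
pose C := [set A : set T |
  [/\ measurable A, inner_closed A & inner_closed (~` A)]].
have: <<s @open X >> `<=` C; last exact.
apply: smallest_sub; [split|].
- split=> //; first exact: inner_closed_closed closed0.
  by rewrite setC0; exact: inner_closed_closed closedT.
- move=> B [mB iB iCB]; rewrite setTD; split; rewrite ?setCK//.
  exact: measurableC.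
- move=> B CB; split.
  + by apply: bigcupT_measurable => n; have [] := CB n.
  + by apply: inner_closed_bigcup => n; have [] := CB n.
  + rewrite setC_bigcup; apply: inner_closed_bigcap => n; have [mB _ iB] := CB n.
      exact: measurableC.
    by [].
- move=> U oU; split; first exact: borel_open.
    have [F cF ->] := open_bigcup_closed dM dX oU.
    apply: inner_closed_bigcup => n; first exact: borel_closed.
    exact: inner_closed_closed.
  by apply: inner_closed_closed; exact: open_closedC.
Qed.

Lemma pos_measure_closed_subset (A : set T) : measurable A -> (0 < mu A)%E ->
  exists F : set X, [/\ closed F, F `<=` A & (0 < mu F)%E].
Proof.
move=> mA A0; have fA : mu A \is a fin_num by exact: fin_num_measure.
have e0 : 0 < fine (mu A) / 2 by rewrite divr_gt0// fine_gt0// A0 ltey_eq fA.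
have [F [cF FA AF]] := borel_inner_closed mA e0.
exists F; split=> //; have mF := borel_closed cF.
rewrite lt0e measure_ge0 andbT; apply/eqP => F0.
have : (mu A <= (fine (mu A) / 2)%:E)%E.
  apply: le_trans AF; rewrite measureD//; last by rewrite ltey_eq fA.
  rewrite (_ : A `&` F = F); last by apply/setIidPr.
  by rewrite [X in (_ - X)%E](_ : _ = 0%E)// sube0.
by rewrite -{1}[mu A]fineK// lee_fin leNgt; move/negP; apply; lra.
Qed.

(** A singleton has only two subsets, so it would be an atom if it had positive
    measure. *)
Lemma nonatomic_set1 (x : X) : nonatomic mu -> mu [set x] = 0%E.
Proof.
move=> na; apply/eqP; rewrite -measure_le0 leNgt; apply/negP => x0.
apply: (na [set x]); split=> //.
  by apply: borel_closed; exact: (closed_metric_set1 dM dX).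
move=> B _ /subset_set1[]->; [left; exact: measure0|by right].
Qed.

Variable u : nat -> X.
Hypothesis u_dense : forall x (e : R), 0 < e -> exists n, dist (u n) x < e.

(** Take a closed [F] of positive measure inside [A] and remove from it all the
    balls of a countable base that meet [F] in a null set.  What is removed is
    null; every neighbourhood of a remaining point still has positive measure in
    the remainder, hence contains other points of it, as points are null. *)
Lemma pos_measure_perf_plus (A : set T) : nonatomic mu ->
  measurable A -> (0 < mu A)%E ->
  exists2 P : set X, perf_plus mu P & P `<=` A.
Proof.
move=> na mA /(pos_measure_closed_subset mA)[F [cF FA F0]].
pose b n m : set X := [set y | dist (u n) y < m.+1%:R^-1].
have ob n m : open (b n m) by exact: open_metric_ball.
pose V : set X := \bigcup_n \bigcup_(m in [set m | mu (F `&` b n m) = 0%E]) b n m.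
have oV : open V by apply: bigcup_open => n _; exact: bigcup_open.
have mF := borel_closed cF; have mV := borel_open oV.
have FV0 : mu (F `&` V) = 0%E.
  apply: measure_negligible; first exact: measurableI.
  rewrite setI_bigcupr; apply: negligible_bigcup => n.
  rewrite setI_bigcupr bigcup_mkcond; apply: negligible_bigcup => m.
  case: ifPn => [/set_mem/= h|_]; last exact: negligible_set0.
  by apply/negligibleP => //; apply: measurableI => //; exact: borel_open.
have cK : closed (F `\` V) by apply: closedI => //; exact: open_closedC.
exists (F `\` V); last by move=> x [/FA].
split; last first.
  rewrite lt_neqAle measure_ge0 andbT eq_sym; apply/eqP => K0.
  have FE : (mu F = mu (F `\` V) + mu (F `&` V))%E := measureDI mu mF mV.
  by move: F0; rewrite FE K0 FV0 adde0 ltxx.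
split=> //; apply/seteqP; split=> [x|x [Fx Vx]].
  by move=> /subset_limit_point; rewrite -(closure_id _).1.
move=> U /dX[e e0 eU].
(* A ball of radius below [e / 2] containing [x] stays within [e] of [x]. *)
have [m _ me] := @near_infty_natSinv_lt R (PosNum (divr_gt0 e0 (ltr0Sn R 1))).
have /= {me} me := me m (leqnn m).
have [n unx] : exists n, dist (u n) x < m.+1%:R^-1.
  by apply: u_dense; rewrite invr_gt0.
have bU : b n m `<=` U.
  move=> y /= uny; apply: eU => /=.
  apply: le_lt_trans (metric_triangle dM (u n) x y) _.
  rewrite (metric_sym dM x) [e]splitr.
  by apply: ltrD; [exact: lt_trans unx me|exact: lt_trans uny me].
apply: contrapT => none; apply: Vx; exists n => //; exists m => //=.
have mb := borel_open (ob n m).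
apply: measure_negligible; first exact: measurableI.
apply: (@negligibleS _ _ _ mu ([set x] `|` (F `&` V))).
  move=> y [Fy by_]; have [->|yx] := eqVneq y x; [by left|right].
  split=> //; apply: contrapT => Vy; apply: none; exists y; split=> //.
  exact: bU.
apply: negligibleU; apply/negligibleP => //.
- by apply: borel_closed; exact: (closed_metric_set1 dM dX).
- exact: nonatomic_set1.
- exact: measurableI.
Qed.

Variable f : X -> R.

(** The two covers, by small balls and by preimages of short intervals, are used
    one after the other. *)
Lemma perf_plus_refine : nonatomic mu -> completion_measurable mu f ->
  forall P (e : R), perf_plus mu P -> 0 < e ->
  exists2 Q, legal_II (perf_plus mu) P Q &
    forall x y, Q x -> Q y -> dist x y < e /\ `|f x - f y| < e.
Proof.
move=> na mf P e [[cP _] P0] e0; have e20 : 0 < e / 2 by rewrite divr_gt0.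
have [n|x _|n [B [mB BP B0]]] := @pos_measure_cover _ T R mu P
    (fun n => [set y | dist (u n) y < e / 2]) (borel_closed cP) P0.
- apply/completed_algebra_genP; exists [set y | dist (u n) y < e / 2]; split=> //.
    exact: borel_open (open_metric_ball dM dX _ _).
  by rewrite setDv; exact: negligible_set0.
- by have [n unx] := u_dense x e20; exists n.
(* [r] runs through the rational numbers. *)
pose r n : R := ratr (odflt 0 (unpickle n)).
have [m|x _|m [A [mA AB A0]]] := @pos_measure_cover _ T R mu B
    (fun m => f @^-1` [set y | `|r m - y| < e / 2]) mB B0.
- apply: completion_measurable_preimage => //.
  rewrite (_ : mkset _ = ball (r m) (e / 2))//; exact: measurable_ball.
- have [q] : exists q : rat, ratr q \in `]f x - e / 2, f x + e / 2[.
    by apply: rat_in_itvoo; lra.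
  rewrite in_itv /= => qx; exists (pickle q) => //=.
  by rewrite /r pickleK /= ltr_distlC; move: qx => /andP[? ?]; apply/andP; split; lra.
have [Q QS QA] := pos_measure_perf_plus na mA A0.
have AP : A `<=` P by move=> x /AB[/BP[]].
exists Q; first by split=> //; exact: subset_trans AP.
move=> x y /QA/AB[/BP[_ /= ux] /= fx] /QA/AB[/BP[_ /= uy] /= fy]; split.
  apply: le_lt_trans (metric_triangle dM (u n) x y) _.
  by rewrite (metric_sym dM x); lra.
apply: le_lt_trans (ler_distD (r m) _ _) _.
by rewrite (distrC (f x)); lra.
Qed.

(** If the maximal Borel subsets [A] of [f < b] and [B] of [a < f] covered almost
    everything, [A] would separate [f <= a] from [b <= f] up to a null set. *)
Lemma perf_plus_gap : nonatomic mu -> ~ completion_measurable mu f ->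
  exists P a b, [/\ perf_plus mu P, a < b &
    forall Q, legal_II (perf_plus mu) P Q ->
     (exists2 x, Q x & f x <= a) /\ (exists2 x, Q x & b <= f x)].
Proof.
move=> na nmf; apply: contrapT => nogap; apply: nmf.
apply: (@completion_measurable_of_separation _ T) => a b ab.
have [A [mA Ab maxA]] := maximal_measurable_subset mu [set x | f x < b].
have [B [mB Ba maxB]] := maximal_measurable_subset mu [set x | a < f x].
exists A; split=> //.
have mD : measurable (~` (A `|` B)) by apply/measurableC/measurableU.
have [D0|] := eqVneq (mu (~` (A `|` B))) 0%E.
  exists (~` (A `|` B)); split=> // x [/= fx nA] [//|/Ba /=].
  by rewrite ltNge fx.
rewrite -measure_gt0 => /(pos_measure_perf_plus na mD)[P SP PD].
case: nogap; exists P, a, b; split=> // Q [[[cQ _] Q0] QP].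
split; apply: contrapT => none; move: Q0; apply/negP; rewrite -leNgt measure_le0;
  apply/eqP; [apply: maxB|apply: maxA]; do ?exact: borel_closed.
- move=> x Qx; split; last by move=> Bx; apply: (PD _ (QP _ Qx)); right.
  by rewrite /= ltNge; apply/negP => ?; apply: none; exists x.
- move=> x Qx; split; last by move=> Ax; apply: (PD _ (QP _ Qx)); left.
  by rewrite /= ltNge; apply/negP => ?; apply: none; exists x.
Qed.

End Regularity.

(** * Determinacy *)

Theorem corollary4p3 (R : realType) (X : ptopologicalType) (f : X -> R)
    (mu : {finite_measure set (g_sigma_algebraType (@open X)) -> \bar R}) :
  polish R X ->
  isolated [set: X] = set0 ->
  nonatomic mu ->
  (0 < mu [set: X])%E ->
  [/\ G1_determined (perf_plus mu) f,
      completion_measurable mu f -> II_has_winning_strategy (perf_plus mu) f &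
      ~ completion_measurable mu f -> I_has_winning_strategy (perf_plus mu) f].
Proof.
move=> [sepX [d [dM dX dC]]] _ na _.
have [u u_dense] := separable_dense_seq dM dX sepX point.
have II : completion_measurable mu f -> II_has_winning_strategy (perf_plus mu) f.
  move=> mf; apply: (II_has_winning_strategy_of_refinement dM dX dC).
    by move=> P [[]].
  exact: (perf_plus_refine dM dX u_dense na mf).
have I : ~ completion_measurable mu f -> I_has_winning_strategy (perf_plus mu) f.
  move=> /(perf_plus_gap dM dX u_dense na)[P [a [b [SP ab gap]]]].
  exact: winning_I_of_gap point SP ab gap.
by split=> //; have [/II|/I] := pselect (completion_measurable mu f); [right|left].
Qed.
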